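(* Let $x>0$ be a real number, $d\ge 1$ an integer, and $r$ a nonzero real number with $r^2\neq x$. Let $g(t)=\frac{1}{t^2-x}$ and let $\{\mathcal{H}_n\}_{n\ge 0}$ be the sequence of Householder's method of order $d$ for $\sqrt{x}$ with starting point $r$, i.e. $$\mathcal{H}_0=r,\qquad \mathcal{H}_{n+1}=\mathcal{H}_n+d\,\frac{g^{(d-1)}(\mathcal{H}_n)}{g^{(d)}(\mathcal{H}_n)}\quad(n\ge 0).$$ Then $\mathcal{H}_0=r$ and for every integer $n\ge 0$, $$\mathcal{H}_{n+1}=\frac{\displaystyle\sum_{k=0}^{\lceil d/2\rceil}\binom{d+1}{2k}\mathcal{H}_n^{\,d+1-2k}x^k}{\displaystyle\sum_{k=0}^{\lfloor d/2\rfloor}\binom{d+1}{1+2k}\mathcal{H}_n^{\,d-2k}x^k}.$$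
   Context: $g^{(m)}$ denotes the $m$-th derivative of $g$, with $g^{(0)}=g$. *)

(* Defs.v *)
From HB Require Import structures.
From mathcomp Require Import all_boot all_order all_algebra.
From mathcomp Require Import all_classical all_reals all_analysis.
Import Order.TTheory GRing.Theory Num.Theory.
Import numFieldNormedType.Exports.

Set Implicit Arguments.
Unset Strict Implicit.
Unset Printing Implicit Defensive.

Local Open Scope ring_scope.

(* The step is written with [g] = 1 / f, where f is the function whose zero is
   sought; the order [d] is meant to be at least 1. *)
Fixpoint householder (R : realType) (d : nat) (g : R -> R) (r : R) (n : nat) : R :=
  if n is m.+1 then
    let h := householder d g r m in
    h + d%:R * (derive1n d.-1 g h / derive1n d g h)
  else r.

(* Main.v *)
Require Import Defs.
From HB Require Import structures.
From mathcomp Require Import all_boot all_order all_algebra.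
From mathcomp Require Import all_classical all_reals all_analysis.
From mathcomp Require Import zify ring.
Import Order.TTheory GRing.Theory Num.Theory.
Import numFieldNormedType.Exports.

Set Implicit Arguments.
Unset Strict Implicit.
Unset Printing Implicit Defensive.

Local Open Scope ring_scope.

(** Put s = sqrt x. Partial fractions turn g into
    (1 / (t - s) - 1 / (t + s)) / (2 s), whose derivatives of every order are
    explicit ([derive1n_recip_sqr]). Substituting them in one step of the method
    ([householder_step_recip_sqr]) gives, for t the current iterate,
      s ((t + s) ^ d.+1 + (t - s) ^ d.+1) / ((t + s) ^ d.+1 - (t - s) ^ d.+1),
    and the binomial theorem shows that the numerator and the denominator are,
    up to the common factor 2 s, the sums over the even and over the odd powers
    of s ([exprD_exprB_even], [exprD_exprB_odd]); only powers of s ^ 2 = x remain.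

    The derivative formula excludes t = s and t = - s; the point t = 0 is excluded
    too, because the denominator vanishes there when d is odd. These conditions
    propagate along the iteration ([householder_neq]). *)

(** Letting the range run past N, where the binomial coefficients vanish, frees
    the parity splittings from having to match N exactly. *)
Lemma exprD_nat_widen (R : comNzRingType) (t s : R) (N M : nat) : (N < M)%N ->
  (t + s) ^+ N = \sum_(0 <= k < M) 'C(N, k)%:R * t ^+ (N - k) * s ^+ k.
Proof.
move=> NM; rewrite (big_cat_nat (n := N.+1))//= [X in _ = _ + X]big1_seq ?addr0.
  rewrite exprDn big_mkord; apply: eq_bigr => k _.
  by rewrite -mulr_natl mulrA.
move=> k; rewrite mem_index_iota => /andP[_ /andP[Nk _]].
by rewrite bin_small ?mulr0n ?mul0r.
Qed.

Lemma big_nat_even_odd (V : nmodType) (F : nat -> V) (m : nat) :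
  \sum_(0 <= k < 2 * m) F k =
  \sum_(0 <= k < m) F (2 * k)%N + \sum_(0 <= k < m) F (1 + 2 * k)%N.
Proof.
elim: m => [|m IHm]; first by rewrite muln0 !big_geq// addr0.
rewrite mulnS add2n !big_nat_recr//= IHm add1n.
by rewrite -!addrA; congr (_ + _); rewrite !addrA; congr (_ + _); rewrite addrC.
Qed.

Lemma exprD_exprB_even (R : comNzRingType) (t s : R) (N m : nat) :
  (N < 2 * m)%N ->
  (t + s) ^+ N + (t - s) ^+ N =
  2 * \sum_(0 <= k < m) 'C(N, 2 * k)%:R * t ^+ (N - 2 * k) * (s ^+ 2) ^+ k.
Proof.
move=> Nm; rewrite !(exprD_nat_widen _ _ Nm) -big_split/= big_nat_even_odd.
rewrite mulr_sumr [X in _ + X]big1 ?addr0.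
  by apply: eq_bigr => k _; rewrite !exprM sqrrN; ring.
by move=> k _; rewrite !add1n !(exprS _ (2 * _)) !exprM sqrrN; ring.
Qed.

(** The range of the expansion is [2 * m + 1], not [2 * m], because an even N may
    equal [2 * m]: that last term has even index and cancels. *)
Lemma exprD_exprB_odd (R : comNzRingType) (t s : R) (N m : nat) :
  (N < (2 * m).+1)%N ->
  (t + s) ^+ N - (t - s) ^+ N =
  2 * s *
    \sum_(0 <= k < m) 'C(N, 1 + 2 * k)%:R * t ^+ (N - (1 + 2 * k)) * (s ^+ 2) ^+ k.
Proof.
move=> Nm; have Nm2 : (N < 2 * m.+1)%N by rewrite mulnS add2n ltnS ltnW.
rewrite !(exprD_nat_widen _ _ Nm) -sumrB big_nat_recr//= big_nat_even_odd.
rewrite [X in X + _ + _]big1 ?add0r; last first.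
  by move=> k _; rewrite !exprM sqrrN; ring.
rewrite !exprM sqrrN subrr addr0 mulr_sumr.
by apply: eq_bigr => k _; rewrite !add1n !(exprS _ (2 * _)) !exprM sqrrN; ring.
Qed.

Lemma is_derive_subVX (R : realFieldType) (a t : R) (m : nat) : t != a ->
  is_derive t 1 (fun u : R => (u - a) ^- m) (- m%:R * (t - a) ^- m.+1).
Proof.
move=> ta; have ta0 : t - a != 0 by rewrite subr_eq0.
have dB : is_derive t 1 (fun u : R => u - a) 1 by exact: is_derive_shift.
have dV : is_derive t 1 (fun u : R => (u - a)^-1) (- (t - a) ^- 2).
  apply: DeriveDef; first exact: derivableV.
  by rewrite deriveV// derive_val /= [_ *: _]mulr1.
have -> : (fun u : R => (u - a) ^- m) = (fun u : R => (u - a)^-1) ^+ m.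
  by apply/funext => u; rewrite exprfctE exprVn.
apply: is_derive_eq; case: m => [|m]; first by rewrite !mul0r scale0r oppr0 mul0r.
rewrite /= scalerN mulNr; congr (- _); rewrite -[LHS]/(m.+1%:R * (t - a)^-1 ^+ m * (t - a) ^- 2).
by rewrite -mulrA -!exprVn -exprD addn2.
Qed.

(** Induction on m; the formula for order m holds on a whole neighbourhood of t,
    since the excluded points are closed, so it can be differentiated. *)
Lemma derive1n_recip_sqr (R : realFieldType) (s t : R) (m : nat) :
  s != 0 -> t != s -> t != - s ->
  derive1n m (fun u : R => 1 / (u ^+ 2 - s ^+ 2)) t =
  (-1) ^+ m * m`!%:R / (2 * s) * ((t - s) ^- m.+1 - (t + s) ^- m.+1).
Proof.
move=> s0; elim: m t => [|m IHm] t ts tNs.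
  have ts0 : t - s != 0 by rewrite subr_eq0.
  have tNs0 : t + s != 0 by rewrite addr_eq0.
  rewrite derive1n0 expr0 fact0 !expr1 subr_sqr.
  by field; rewrite s0 ts0 tNs0.
rewrite derive1nS derive1E.
set c := (-1) ^+ m * m`!%:R / (2 * s) in IHm *.
rewrite (@near_eq_derive _ _ _ _ (fun u : R =>
    c * ((u - s) ^- m.+1 - (u - - s) ^- m.+1))); last first.
  near=> u; rewrite IHm ?opprK//.
    by near: u; exact: open_nbhs_nbhs (conj (@open_neq R s) ts).
  by near: u; exact: open_nbhs_nbhs (conj (@open_neq R (- s)) tNs).
have dp := is_derive_subVX m.+1 ts.
have dm := is_derive_subVX m.+1 tNs.
rewrite deriveZ/= ?derive_val; last exact: derivableB.
rewrite opprK factS natrM (exprS (-1)).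
rewrite -[LHS]/(c * (- m.+1%:R * (t - s) ^- m.+2 - - m.+1%:R * (t + s) ^- m.+2)).
by rewrite /c; ring.
Unshelve. all: by end_near. Qed.

(** Equal or opposite m-th powers would force (t + s) ^ 2 = (t - s) ^ 2, that is
    4 t s = 0. *)
Lemma expr_add_sub_neq0 (R : realFieldType) (s t : R) (m : nat) :
  (0 < m)%N -> s != 0 -> t != 0 ->
  (t + s) ^+ m - (t - s) ^+ m != 0 /\ (t + s) ^+ m + (t - s) ^+ m != 0.
Proof.
move=> m0 s0 t0; apply/andP.
rewrite -negb_or -mulf_eq0 -subr_sqr -!exprM mulnC !exprM subr_eq0.
rewrite eqrXn2 ?sqr_ge0// -subr_eq0.
have -> : (t + s) ^+ 2 - (t - s) ^+ 2 = 4 * (t * s) by ring.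
by rewrite !mulf_neq0// pnatr_eq0.
Qed.

(** Writing a = t - s and b = t + s, the quotient of derivatives is
    - a b (b ^ d - a ^ d) / (b ^ d.+1 - a ^ d.+1) divided by d, and adding
    t = (a + b) / 2 collapses the numerator to s (b ^ d.+1 + a ^ d.+1). *)
Lemma householder_step_recip_sqr (R : realFieldType) (s t : R) (d : nat) :
  (0 < d)%N -> s != 0 -> t != 0 -> t != s -> t != - s ->
  let g := fun u : R => 1 / (u ^+ 2 - s ^+ 2) in
  t + d%:R * (derive1n d.-1 g t / derive1n d g t) =
  s * ((t + s) ^+ d.+1 + (t - s) ^+ d.+1) / ((t + s) ^+ d.+1 - (t - s) ^+ d.+1).
Proof.
case: d => // e _ s0 t0 ts tNs g.
have a0 : t - s != 0 by rewrite subr_eq0.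
have b0 : t + s != 0 by rewrite addr_eq0.
have [D0 _] := expr_add_sub_neq0 (ltn0Sn e.+1) s0 t0.
rewrite /g !derive1n_recip_sqr// factS natrM (exprS (-1)).
rewrite !(exprS _ e.+1) in D0 *.
have P0 : (t - s) ^+ e.+1 != 0 by rewrite expf_neq0.
have Q0 : (t + s) ^+ e.+1 != 0 by rewrite expf_neq0.
have f0 : e`!%:R != 0 :> R by rewrite pnatr_eq0 -lt0n fact_gt0.
have k0 : e.+1%:R != 0 :> R by rewrite pnatr_eq0.
have n0 : (-1) ^+ e != 0 :> R by rewrite expf_neq0// oppr_eq0 oner_eq0.
move: ((t - s) ^+ e.+1) ((t + s) ^+ e.+1) (e`!%:R : R) (e.+1%:R : R)
  ((-1) ^+ e : R) P0 Q0 f0 k0 n0 D0 => P Q f k n P0 Q0 f0 k0 n0 D0.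
by field; rewrite D0 Q0 b0 P0 a0 s0 f0 k0 n0.
Qed.

(** In the coordinate z = (t + s) / (t - s) the step is z |-> z ^ d.+1. The points
    - s, s and 0 are z = 0, z = infinity and z = -1, and z = 1 is never taken by a
    finite t; the positive powers of a real z other than 0, 1 and -1 avoid these too. *)
Lemma householder_neq (R : realType) (s r : R) (d n : nat) :
  (0 < d)%N -> s != 0 -> r != 0 -> r != s -> r != - s ->
  let h := householder d (fun u : R => 1 / (u ^+ 2 - s ^+ 2)) r n in
  [/\ h != 0, h != s & h != - s].
Proof.
move=> d0 s0 r0 rs rNs /=; elim: n => [//|n [t0 ts tNs]] /=.
set t := householder _ _ _ _ in t0 ts tNs *.
rewrite householder_step_recip_sqr//.
have [D0 S0] := expr_add_sub_neq0 (ltn0Sn d) s0 t0.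
have A0 : (t - s) ^+ d.+1 != 0 by rewrite expf_neq0// subr_eq0.
have B0 : (t + s) ^+ d.+1 != 0 by rewrite expf_neq0// addr_eq0.
move: ((t - s) ^+ d.+1) ((t + s) ^+ d.+1) A0 B0 D0 S0 => A B A0 B0 D0 S0.
split; first by rewrite !mulf_neq0// invr_eq0.
- rewrite -subr_eq0.
  have -> : s * (B + A) / (B - A) - s = 2 * s * A / (B - A) by field.
  by rewrite !mulf_neq0 ?invr_eq0// pnatr_eq0.
- rewrite -addr_eq0.
  have -> : s * (B + A) / (B - A) + s = 2 * s * B / (B - A) by field.
  by rewrite !mulf_neq0 ?invr_eq0// pnatr_eq0.
Qed.

Theorem theorem7 (R : realType) (x r : R) (d : nat)
    (x_gt0 : 0 < x) (d_ge1 : (1 <= d)%N) (r_neq0 : r != 0)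
    (r2_neqx : r ^+ 2 != x) :
  let g := fun t : R => 1 / (t ^+ 2 - x) in
  let H := householder d g r in
  H 0%N = r /\
  forall n : nat,
    H n.+1 =
      (\sum_(0 <= k < (uphalf d).+1)
          'C(d.+1, 2 * k)%:R * H n ^+ (d.+1 - 2 * k) * x ^+ k) /
      (\sum_(0 <= k < (d./2).+1)
          'C(d.+1, 1 + 2 * k)%:R * H n ^+ (d - 2 * k) * x ^+ k).
Proof.
move=> g H; split=> // n.
have s0 : Num.sqrt x != 0 by rewrite sqrtr_eq0 -ltNge.
have sx : Num.sqrt x ^+ 2 = x by rewrite sqr_sqrtr// ltW.
set s := Num.sqrt x in s0 sx.
have [rs rNs] : r != s /\ r != - s.
  by apply/andP; rewrite -negb_or -eqf_sqr sx.
have gE : g = (fun u : R => 1 / (u ^+ 2 - s ^+ 2)) by rewrite sx.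
have [t0 ts tNs] : [/\ H n != 0, H n != s & H n != - s].
  by rewrite /H gE; exact: householder_neq.
have -> : H n.+1 =
    H n + d%:R * (derive1n d.-1 g (H n) / derive1n d g (H n)) by [].
rewrite gE householder_step_recip_sqr//.
have [D0 _] := expr_add_sub_neq0 (ltn0Sn d) s0 t0.
have Nev : (d.+1 < 2 * (uphalf d).+1)%N by lia.
have Nodd : (d.+1 < (2 * (d./2).+1).+1)%N by lia.
have sumE := exprD_exprB_even (H n) s Nev.
have difE := exprD_exprB_odd (H n) s Nodd.
rewrite sumE {}difE sx in D0 *.
set E := \sum_(0 <= k < (uphalf d).+1) _.
(* The exponents [d.+1 - (1 + 2 * k)] and [d - 2 * k] are convertible, so this
   abbreviates both copies of the odd sum. *)
set O := \sum_(0 <= k < (d./2).+1) _ in D0 *.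
have O0 : O != 0 by apply: contraNneq D0 => ->; rewrite mulr0.
by field; rewrite O0.
Qed.
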